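(* Let $G$ be a finite abelian group and let $A$, $B$, $S$ be non-empty subsets of $G$. Suppose that $$\min\{|A|,|B|\}\geq 9|S|^2-5|S|-3.$$ Then $$|A\oplus_S B|\geq \min\{|A|+|B|-|S|-2,\ p(G)\}.$$
   Context: For subsets $A,B,S$ of an abelian group $G$ (written additively), the generalized restricted sumset is $A\oplus_S B:=\{a+b:\ a\in A,\ b\in B,\ a-b\notin S\}$. For a finite group $G$ with $|G|>1$, $p(G)$ denotes the least prime factor of $|G|$. *)

(* Defs.v *)
From HB Require Import structures.
From mathcomp Require Import all_boot all_order all_algebra.
Set Implicit Arguments. Unset Strict Implicit. Unset Printing Implicit Defensive.
Import GRing.Theory.
Local Open Scope ring_scope.

Definition restricted_sumset (G : finZmodType) (S A B : {set G}) : {set G} :=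
  [set a + b | a in A, b in B & a - b \notin S].

(* p(G): least prime factor of |G| (pdiv; meaningful for |G| > 1). *)
Definition pG (G : finZmodType) : nat := pdiv #|[set: G]|.

(* Main.v *)
Require Import Defs.
From HB Require Import structures.
From mathcomp Require Import all_boot all_order all_algebra.
From mathcomp Require Import all_fingroup all_solvable.
From mathcomp Require Import ring zify.
Set Implicit Arguments. Unset Strict Implicit. Unset Printing Implicit Defensive.
Import GRing.Theory FinRing.Theory.

(* In a field of prime order q the bound |A| + |B| - |S| - 2 holds for all A, B and
   0 < |S| < q: by the Nullstellensatz its failure would produce two consecutive vanishing
   coefficients of (X - 1)^s (X + 1)^m with s, m < q, which a first-order differential
   equation excludes.

   A general group is treated by descending to a subgroup K of prime index q in H: A and B
   are cut into fibres over 'F_q, the prime case (or Cauchy-Davenport) counts the fibres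
   that the sumset meets, and the induction hypothesis for K bounds its fibres over one
   translate of the image of A, namely that by the index of a largest fibre of B.  Unless
   A and B both lie in a single coset of K, or one of them has only singleton fibres, the
   fibres overlap with room to spare, and it is enough to know inside K the weaker
   bound |A| + |B| - 3 |S|^2, which is proved first by the same descent and needs no
   assumption on the sizes. *)

(** * A polynomial without consecutive zero coefficients *)

Section Polynomials.
Local Open Scope ring_scope.
Variable F : fieldType.
Implicit Types (L g : {poly F}).

Lemma Xsub1E : 'X - 1 = 'X - 1%:P :> {poly F}.
Proof. by rewrite polyC1. Qed.

Lemma Xadd1E : 'X + 1 = 'X - (-1)%:P :> {poly F}.
Proof. by rewrite polyCN opprK. Qed.

(** At 1 the equation reads [2 s L(1) = 0], at -1 it reads [-2 m L(-1) = 0]. So [L] has that root,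
    and its quotient by the linear factor solves the same equation with [s], resp. [m], lowered by
    one. *)
Lemma dvdp_of_ode (s m : nat) L :
    2%:R != 0 :> F ->
    (forall n, (0 < n <= s)%N -> n%:R != 0 :> F) ->
    (forall n, (0 < n <= m)%N -> n%:R != 0 :> F) ->
    L^`() * ('X^2 - 1) = (s%:R *: ('X + 1) + m%:R *: ('X - 1)) * L ->
  ('X - 1) ^+ s * ('X + 1) ^+ m %| L.
Proof.
move=> two_n0; elim: s L => [|s IHs] L hs hm.
  elim: m L hm => [|m IHm] L hm; first by rewrite !expr0 mulr1 dvd1p.
  move=> hL; have /factor_theorem [M hM] : root L (-1).
    have := congr1 (horner^~ (-1)) hL.
    rewrite !hornerE /= => /eqP; rewrite ?sqrrN ?expr1n subrr mulr0 eq_sym.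
    rewrite mulf_eq0 => /orP[|//].
    rewrite -opprD -[1 + 1]/(2%:R) mulrN oppr_eq0 mulf_eq0.
    by rewrite (negPf two_n0) orbF (negPf (hm _ _)) // ltnS leqnn.
  have X1 : 'X - (-1)%:P = 'X + 1 :> {poly F} by rewrite polyCN opprK.
  have X1_n0 : 'X + 1 != 0 :> {poly F} by rewrite -X1 polyXsubC_eq0.
  rewrite X1 in hM; rewrite expr0 mul1r exprSr hM dvdp_mul2r //.
  have := IHm M; rewrite expr0 mul1r; apply.
    by move=> n /andP[n0 nm]; apply: hm; rewrite n0 ltnW.
  move: hL; rewrite hM => hL; apply: (mulIf X1_n0).
  move: hL; rewrite derivM derivD derivX derivC.
  rewrite -!mul_polyC -[m.+1]addn1 natrD polyCD => hL.
  apply: etrans (_ : (M^`() * ('X + 1) + M * (1 + 0)) * ('X^2 - 1) - M * ('X^2 - 1) = _); first ring.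
  rewrite hL polyC1 polyC0; ring.
move=> hL; have /factor_theorem [M hM] : root L 1.
  have := congr1 (horner^~ 1) hL.
  rewrite !hornerE /= => /eqP; rewrite ?expr1n subrr mulr0 eq_sym.
  rewrite mulf_eq0 => /orP[|//].
  rewrite mulr0 addr0 -[1 + 1]/(2%:R) mulf_eq0.
  by rewrite (negPf two_n0) orbF (negPf (hs _ _)) // ltnS leqnn.
have X1 : 'X - 1%:P = 'X - 1 :> {poly F} by rewrite polyC1.
have X1_n0 : 'X - 1 != 0 :> {poly F} by rewrite -X1 polyXsubC_eq0.
rewrite X1 in hM; rewrite exprSr mulrAC hM dvdp_mul2r //.
apply: IHs => //.
  by move=> n /andP[n0 nm]; apply: hs; rewrite n0 ltnW.
move: hL; rewrite hM => hL; apply: (mulIf X1_n0).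
move: hL; rewrite derivM derivB derivX derivC.
rewrite -!mul_polyC -[s.+1]addn1 natrD polyCD => hL.
apply: etrans (_ : (M^`() * ('X - 1) + M * (1 - 0)) * ('X^2 - 1) - M * ('X^2 - 1) = _); first ring.
rewrite hL polyC1 ?polyC0; ring.
Qed.

(** Vanishing means that [h] has the logarithmic derivative [s / (X - 1) + m / (X + 1)] of
    [(X - 1)^s (X + 1)^m], denominators cleared. *)
Definition ode_defect (s m : nat) (h : {poly F}) : {poly F} :=
  h^`() * ('X^2 - 1) - (s%:R *: ('X + 1) + m%:R *: ('X - 1)) * h.

Lemma ode_defectD s m u v : ode_defect s m (u + v) = ode_defect s m u + ode_defect s m v.
Proof. by rewrite /ode_defect derivD; ring. Qed.

Lemma ode_defect_prod s m : ode_defect s m (('X - 1) ^+ s * ('X + 1) ^+ m) = 0.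
Proof.
  have expE n (u : {poly F}) : n%:R * u ^+ n.-1 * u = n%:R * u ^+ n.
    by case: n => [|n]; rewrite ?mul0r // -mulrA -exprSr.
  have X1D : ('X - 1 : {poly F})^`() = 1 by rewrite derivB derivX derivC subr0.
  have X1D' : ('X + 1 : {poly F})^`() = 1 by rewrite derivD derivX derivC addr0.
  have derE n (u : {poly F}) : (u ^+ n)^`() = u^`() * (n%:R * u ^+ n.-1).
    by rewrite deriv_exp -[LHS]mulr_natl; ring.
  rewrite /ode_defect derivM !derE X1D X1D' !mul1r -!mul_polyC !polyC_natr.
  have := expE s ('X - 1); have := expE m ('X + 1).
  set P := _ ^+ m.-1; set Q := _ ^+ s.-1; set P' := _ ^+ m; set Q' := _ ^+ s.
  move=> hP hQ.
  apply: etrans (_ : (s%:R * Q * ('X - 1)) * P' * ('X + 1)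
    + Q' * (m%:R * P * ('X + 1)) * ('X - 1)
    - (s%:R * ('X + 1) + m%:R * ('X - 1)) * (Q' * P') = _); first ring.
  by rewrite hP hQ; ring.
Qed.

Lemma size_ode_defect s m i L : (size L <= i)%N -> (size (ode_defect s m L) <= i.+1)%N.
Proof.
move=> szL.
have szX : (size ('X^2 - 1 : {poly F})%R <= 3)%N.
  by rewrite (leq_trans (size_polyD _ _)) // size_polyXn size_polyN size_polyC oner_eq0.
have szl : (size (s%:R *: ('X + 1) + m%:R *: ('X - 1) : {poly F})%R <= 2)%N.
  rewrite (leq_trans (size_polyD _ _)) // geq_max Xsub1E Xadd1E.
  by rewrite !(leq_trans (size_scale_leq _ _)) // size_XsubC.
have szL' : (size L^`() <= i.-1)%N.
  case: (eqVneq L 0) => [->|L0]; first by rewrite deriv0 size_poly0.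
  by rewrite -ltnS (leq_trans (lt_size_deriv L0)) // (leq_trans szL) // leqSpred.
rewrite /ode_defect (leq_trans (size_polyD _ _)) // geq_max size_polyN.
apply/andP; split; last first.
  by rewrite (leq_trans (size_polyMleq _ _)) // -subn1 leq_subLR (leq_add szl szL).
(* At [i = 0] the predecessor truncates and the size count would overshoot; there the derivative is
   zero. *)
case: (posnP i) => [i0|i_gt0].
  suff -> : L^`() = 0 by rewrite mul0r size_poly0.
  by apply/eqP; rewrite -size_poly_leq0 (leq_trans szL') // i0.
rewrite (leq_trans (size_polyMleq _ _)) // -subn1 leq_subLR.
rewrite (leq_trans (leq_add szL' szX)) //; lia.
Qed.

(** A first-order operator lowers the order of vanishing at 0 by at most one. *)
Lemma coef_ode_defect_mulXn s m i U n : (n < i)%N -> (ode_defect s m (U * 'X^(i.+1)))`_n = 0.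
Proof.
move=> ni; rewrite /ode_defect derivM derivXn -pred_Sn -mulr_natr.
set l := (_ + _ *: _).
rewrite (_ : _ - _ = ((U^`() * 'X + U * i.+1%:R) * ('X^2 - 1) - l * U * 'X) * 'X^i).
  by rewrite coefMXn ni.
rewrite ['X^(i.+1)]exprS; ring.
Qed.

(* Otherwise the part of degree less than [i] of this polynomial solves the same
   differential equation, hence is a multiple of it, hence vanishes, and so does the
   constant coefficient. *)
Lemma consecutive_coefs_neq0 (s m i : nat) (g : {poly F}) :
    2%:R != 0 :> F ->
    (forall n, (0 < n <= s)%N -> n%:R != 0 :> F) ->
    (forall n, (0 < n <= m)%N -> n%:R != 0 :> F) ->
    g = ('X - 1) ^+ s * ('X + 1) ^+ m ->
    (i <= s + m)%N -> g`_i = 0 -> g`_i.+1 = 0 -> False.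
Proof.
move=> two_n0 hs hm gdef ism gi0 gi1.
have g0 : g`_0 != 0.
  rewrite -horner_coef0 gdef !(horner_exp, hornerE) ?sub0r ?add0r expr1n mulr1.
  by rewrite expf_eq0 oppr_eq0 oner_eq0 andbF.
have szg : size g = (s + m).+1.
  rewrite gdef Xsub1E Xadd1E size_mul ?expf_neq0 ?polyXsubC_eq0 //.
  by rewrite !size_exp_XsubC addSn addnS.
pose L := take_poly i g; pose U := drop_poly i.+2 g.
have gE : g = L + U * 'X^(i.+2).
  rewrite -[LHS](poly_take_drop i.+2) -/U; congr (_ + _).
  apply/polyP => n; rewrite !coef_take_poly !ltnS leq_eqVlt ltnS.
  case: eqVneq => [->|_] /=; first by rewrite gi1 ltnNge leqnSn.
  by rewrite leq_eqVlt; case: eqVneq => [->|_] //=; rewrite gi0 ltnn.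
have szL : (size L <= i)%N by apply: size_take_poly.
(* The defect of [L] lives in degrees at most [i], that of [U * 'X^(i.+2)] in degrees above [i];
   their sum is zero, so each of them is. *)
have DL : ode_defect s m L = 0.
  have DLU : ode_defect s m L = - ode_defect s m (U * 'X^(i.+2)).
    by apply/eqP; rewrite -addr_eq0 -ode_defectD -gE gdef ode_defect_prod.
  apply/polyP => n; rewrite coef0; case: (leqP i.+1 n) => [ni|ni].
    by rewrite nth_default // (leq_trans (size_ode_defect _ _ szL)).
  by rewrite DLU coefN coef_ode_defect_mulXn ?oppr0.
have : g %| L by rewrite gdef; apply: dvdp_of_ode => //; apply/subr0_eq.
case: (eqVneq L 0) => [L0 _|L0 /dvdp_leq]; last first.
  by move=> /(_ L0); rewrite szg leqNgt ltnS (leq_trans szL).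
by move: g0; rewrite gE L0 add0r coefMXn eqxx.
Qed.
End Polynomials.

Section Nullstellensatz.
Local Open Scope ring_scope.
Variable F : finFieldType.
Implicit Types (A B : {set F}).

(* The weights are those of Lagrange interpolation at the points of [A]. *)
Lemma coef_functional A : (0 < #|A|)%N ->
  exists w : F -> F, forall n, (n < #|A|)%N ->
    \sum_(x in A) w x * x ^+ n = (n == #|A|.-1)%:R.
Proof.
move=> A_gt0; pose N x : {poly F} := \prod_(y in A :\ x) ('X - y%:P).
pose w x : F := (\prod_(y in A :\ x) (x - y))^-1.
have NE x : (N x).[x] * w x = 1.
  rewrite /N horner_prod (eq_bigr (fun y => x - y)) => [|y _]; last by rewrite !hornerE.
  rewrite mulfV //; apply/prodf_neq0 => y; rewrite in_setD1 subr_eq0.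
  by case/andP; rewrite eq_sym.
have N0 x y : y \in A -> y != x -> (N x).[y] = 0.
  move=> yA yx; rewrite /N horner_prod (bigD1 y) ?in_setD1 ?yx //=.
  by rewrite !hornerE subrr mul0r.
have sN x : x \in A -> size (N x) = #|A|.
  move=> xA; rewrite /N -big_enum size_prod_XsubC -cardE.
  by rewrite (cardsD1 x A) xA.
have lN x : x \in A -> (N x)`_#|A|.-1 = 1.
  move=> xA; have /monicP := monic_prod_XsubC (enum (A :\ x)) xpredT id.
  by rewrite big_enum /= -/(N x) lead_coefE sN.
exists w => n nA; pose P : {poly F} := \sum_(x in A) (w x * x ^+ n) *: N x.
(* Both sides have size at most [#|A|] and agree on [A]. Comparing their coefficients of index
   [#|A|.-1] gives the claim. *)
have PE : P = 'X^n.
  apply/eqP; rewrite -subr_eq0; apply/eqP.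
  apply: (@roots_geq_poly_eq0 _ _ (enum A)); last 2 first.
  - exact: enum_uniq.
  - rewrite -cardE (leq_trans (size_polyD _ _)) // geq_max size_polyN size_polyXn nA andbT.
    apply: (leq_trans (size_sum _ _ _)); apply/bigmax_leqP => x xA.
    by rewrite (leq_trans (size_scale_leq _ _)) // sN.
  apply/allP => y; rewrite mem_enum => yA; rewrite /root !hornerE horner_sum.
  rewrite (bigD1 y) //= big1 => [|x /andP[xA xy]]; last first.
    by rewrite hornerZ N0 ?mulr0 // eq_sym.
  by rewrite hornerZ mulrAC mulrC [w y * _]mulrC NE mulr1 addr0 subrr.
have := congr1 (fun p : {poly F} => p`_#|A|.-1) PE; rewrite coefXn eq_sym => <-.
rewrite coef_sum; apply: eq_bigr => x xA.
by rewrite coefZ lN // mulr1.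
Qed.

(* Combinatorial Nullstellensatz for a product of linear forms in two variables:
   each [r = (e, c)] in [l] stands for the factor [x + e * y - c]. *)
Lemma coef_prod_linear_eq0 A B (l : seq (F * F)) :
    (0 < #|A|)%N -> (0 < #|B|)%N -> (size l + 2 = #|A| + #|B|)%N ->
    (forall x y, x \in A -> y \in B -> exists2 r, r \in l & x + r.1 * y - r.2 = 0) ->
  (\prod_(r <- l) ('X + r.1%:P))`_#|A|.-1 = 0.
Proof.
move=> A_gt0 B_gt0 szl hl.
have [u hu] := coef_functional A_gt0; have [v hv] := coef_functional B_gt0.
have [a aE] : exists a, a = #|A| by exists #|A|.
have [b bE] : exists b, b = #|B| by exists #|B|.
rewrite -!(aE, bE) in A_gt0 B_gt0 szl hu hv *.
(* The functional kills every monomial of total degree at most [a + b - 2] except [x^(a-1) y^(b-1)].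
   Only the top homogeneous part can contain that one, so the constants [c] drop out and setting
   [y = 1] leaves a univariate coefficient. *)
have key i j (l' : seq (F * F)) : (i + j + size l' + 2 <= a + b)%N ->
    \sum_(x in A) \sum_(y in B) u x * v y *
      (x ^+ i * y ^+ j * \prod_(r <- l') (x + r.1 * y - r.2)) =
    if (i + j + size l' + 2 == a + b)%N
    then ('X^i * \prod_(r <- l') ('X + r.1%:P))`_a.-1 else 0.
  elim: l' i j => [|[e c] l' IH] i j.
    rewrite /= addn0 big_nil mulr1 coefXn => hij.
    transitivity ((\sum_(x in A) u x * x ^+ i) * (\sum_(y in B) v y * y ^+ j)).
      rewrite mulr_suml; apply: eq_bigr => x _; rewrite mulr_sumr.
      by apply: eq_bigr => y _; rewrite big_nil; ring.
    (* If [i >= a] then [j < b - 1], and the weights [v] annihilate [y ^ j]. *)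
    case: (ltnP i a) => iA; last first.
      rewrite (hv j) ?[X in _ * X](_ : _ = 0) ?mulr0; last 2 first.
      - by rewrite (_ : (j == _) = false) ?mulr0n //; lia.
      - lia.
      by rewrite (_ : (a.-1 == i) = false) ?mulr0n ?if_same //; lia.
    rewrite hu // [a.-1 == i]eq_sym; case: (eqVneq i a.-1) => [iE|_]; last first.
      by rewrite mul0r if_same.
    rewrite mul1r hv; last by lia.
    suff -> : (j == b.-1) = (i + j + 2 == a + b)%N by case: eqP.
    by lia.
  rewrite /= => hij.
  have E : \sum_(x in A) \sum_(y in B) u x * v y *
      (x ^+ i * y ^+ j * \prod_(r <- (e, c) :: l') (x + r.1 * y - r.2)) =
    \sum_(x in A) \sum_(y in B) u x * v y *
      (x ^+ i.+1 * y ^+ j * \prod_(r <- l') (x + r.1 * y - r.2)) +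
    e * (\sum_(x in A) \sum_(y in B) u x * v y *
      (x ^+ i * y ^+ j.+1 * \prod_(r <- l') (x + r.1 * y - r.2))) -
    c * (\sum_(x in A) \sum_(y in B) u x * v y *
      (x ^+ i * y ^+ j * \prod_(r <- l') (x + r.1 * y - r.2))).
    rewrite !mulr_sumr -big_split -sumrB /=; apply: eq_bigr => x _.
    rewrite !mulr_sumr -big_split -sumrB /=; apply: eq_bigr => y _.
    by rewrite big_cons !exprS /=; ring.
  rewrite {}E !IH; try lia.
  rewrite (_ : (i + j + size l' + 2 == _)%N = false); last lia.
  rewrite !addSn !addnS !addSn mulr0 subr0; case: eqP => _; last by rewrite mulr0 addr0.
  rewrite big_cons /= -coefCM -coefD; congr (nth 0 (polyseq _) _); rewrite ['X^(i.+1)]exprS; ring.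
have := @key 0%N 0%N l; rewrite !add0n szl eqxx leqnn expr0 mul1r => /(_ isT) <-.
apply: big1 => x xA; apply: big1 => y yB.
have [r rl r0] := hl x y xA yB.
by rewrite (big_rem r) //= r0 mul0r !mulr0.
Qed.
End Nullstellensatz.

(** * Restricted sumsets in fields of prime order *)

Section RestrictedSumset.
Local Open Scope ring_scope.
Variable G : finZmodType.
Implicit Types (A B S : {set G}).

Lemma restricted_sumsetP S A B c :
  reflect (exists a b, [/\ a \in A, b \in B, a - b \notin S & c = a + b])
          (c \in restricted_sumset S A B).
Proof.
apply: (iffP imset2P) => [[a b aA]|[a [b [aA bB abS ->]]]].
  by rewrite inE => /andP[bB abS] ->; exists a, b.
by exists a b; rewrite ?inE ?bB.
Qed.

Lemma restricted_sumset_sub S S' A A' B B' :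
    S' \subset S -> A \subset A' -> B \subset B' ->
  restricted_sumset S A B \subset restricted_sumset S' A' B'.
Proof.
move=> /subsetP sS /subsetP sA /subsetP sB.
apply/subsetP => c /restricted_sumsetP[a [b [/sA aA /sB bB abS ->]]].
by apply/restricted_sumsetP; exists a, b; split=> //; apply: contra abS; apply: sS.
Qed.

Lemma card_oppset S : #|[set - x | x in S]| = #|S|.
Proof. exact: card_imset oppr_inj. Qed.

Lemma restricted_sumsetC S A B :
  restricted_sumset S A B = restricted_sumset [set - x | x in S] B A.
Proof.
have oppS x : (- x \in [set - y | y in S]) = (x \in S).
  by apply: mem_imset oppr_inj.
apply/setP => c; apply/restricted_sumsetP/restricted_sumsetP => -[a [b [aA bB abS ->]]];
  exists b, a; split=> //; do ?exact: addrC.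
- by rewrite -opprB oppS.
- by rewrite -oppS opprB.
Qed.

Lemma leq_card_restricted_sumset S A B : B != set0 ->
  (#|A| <= #|restricted_sumset S A B| + #|S|)%N.
Proof.
case/set0Pn => b bB.
rewrite -(card_imset (mem A) (addIr b)) -(card_imset (mem S) (addIr (b + b))).
apply: leq_trans (leq_card_setU _ _); apply/subset_leq_card/subsetP => c.
case/imsetP => a aA ->; rewrite inE; have [abS|abS] := boolP (a - b \in S).
  by apply/orP; right; apply/imsetP; exists (a - b); rewrite // addrA subrK.
by apply/orP; left; apply/restricted_sumsetP; exists a, b.
Qed.

Lemma leq_card_restricted_sumsetr S A B : A != set0 ->
  (#|B| <= #|restricted_sumset S A B| + #|S|)%N.
Proof.
by move=> A0; rewrite restricted_sumsetC -(card_oppset S) leq_card_restricted_sumset.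
Qed.

End RestrictedSumset.

Section PrimeField.
Local Open Scope ring_scope.

Lemma natr_Fp_neq0 q n : prime q -> (0 < n < q)%N -> n%:R != 0 :> 'F_q.
Proof.
move=> q_pr /andP[n_gt0 nq]; rewrite -(dvdn_pcharf (pchar_Fp q_pr)).
by rewrite gtnNdvd.
Qed.

Lemma exists_subset_card (T : finType) (A : {set T}) n : (n <= #|A|)%N ->
  exists2 A' : {set T}, A' \subset A & #|A'| = n.
Proof.
move=> nA; exists [set x in take n (enum A)].
  by apply/subsetP => x; rewrite inE => /mem_take; rewrite mem_enum.
rewrite cardsE; have /card_uniqP -> : uniq (take n (enum A)) by rewrite take_uniq ?enum_uniq.
by rewrite size_takel // -cardE.
Qed.

(* The two middle coefficients come from applying the Nullstellensatz after deleting
   one point from [A], resp. from [B]. *)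
Lemma card_restricted_sumset_small q (A B S : {set 'F_q}) :
    prime q -> (2 < q)%N -> (#|S| < q)%N -> (1 < #|A|)%N -> (1 < #|B|)%N ->
    (#|A| + #|B| <= q + #|S| + 2)%N ->
  (#|A| + #|B| <= #|restricted_sumset S A B| + #|S| + 2)%N.
Proof.
move=> q_pr q_gt2 Sq A_gt1 B_gt1 ABq; rewrite leqNgt; apply/negP => small.
set C := restricted_sumset S A B in small.
(* Chosen so that [m + #|S| + 2] is [#|A| + #|B| - 1], the total size after one point is deleted. *)
pose m := (#|A| + #|B| - #|S| - 3)%N.
have mq : (m < q)%N by lia.
have Cm : (#|C| <= m)%N by lia.
(* Factors [x + y - c] for [c] in [C], then [x + y] as padding up to degree [m], then [x - y - c]
   for [c] in [S]: each pair in [A], [B] is a zero of one of them. *)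
pose l := [seq (1, c) | c <- enum C] ++ nseq (m - #|C|) (1, 0)
          ++ [seq (-1, c) | c <- enum S] : seq ('F_q * 'F_q).
have szl : size l = (m + #|S|)%N.
  by rewrite !size_cat !size_map size_nseq -!cardE addnA subnKC.
have prodl : \prod_(r <- l) ('X + (r.1)%:P) = ('X - 1) ^+ #|S| * ('X + 1) ^+ m :> {poly 'F_q}.
  rewrite !big_cat !big_map /= !big_const_seq !count_predT -!cardE.
  rewrite big_nseq !iter_mulr_1 polyCN polyC1 mulrA -exprD subnKC // mulrC.
  by [].
have zero (A' B' : {set 'F_q}) : A' \subset A -> B' \subset B -> (0 < #|A'|)%N -> (0 < #|B'|)%N ->
    (#|A'| + #|B'| = m + #|S| + 2)%N ->
    (('X - 1) ^+ #|S| * ('X + 1) ^+ m : {poly 'F_q})`_#|A'|.-1 = 0.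
  move=> /subsetP sA /subsetP sB A0 B0 szAB; rewrite -prodl.
  apply: (@coef_prod_linear_eq0 _ _ _ l A0 B0); first by rewrite szl szAB.
  move=> x y /sA xA /sB yB; have [xyS|xyS] := boolP (x - y \in S).
    exists (-1, x - y) => /=; last by rewrite mulN1r subrr.
    by rewrite !mem_cat (map_f (fun c => (-1, c))) ?orbT // mem_enum.
  exists (1, x + y) => /=; last by rewrite mul1r subrr.
  rewrite mem_cat (map_f (fun c => (1, c))) // mem_enum.
  by apply/restricted_sumsetP; exists x, y.
have [A' sA cA] := @exists_subset_card _ A #|A|.-1 (leq_pred _).
have [B' sB cB] := @exists_subset_card _ B #|B|.-1 (leq_pred _).
have := zero A' B sA (subxx B); rewrite cA => z1.
have := zero A B' (subxx A) sB; rewrite cB => z2.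
apply: (@consecutive_coefs_neq0 'F_q #|S| m #|A|.-1.-1 _ _ _ _ erefl).
- by apply: natr_Fp_neq0.
- by move=> n /andP[n0 nS]; apply: natr_Fp_neq0; rewrite // n0 (leq_ltn_trans nS).
- by move=> n /andP[n0 nS]; apply: natr_Fp_neq0; rewrite // n0 (leq_ltn_trans nS).
- lia.
- apply: z1; lia.
- by rewrite (_ : _.-1.-1.+1 = #|A|.-1); [apply: z2|]; lia.
Qed.

(** If [#|A| + #|B|] exceeds [q + #|S| + 2], shrinking [B] to reach equality already gives [q] sums.
    When [A] or [B] is a singleton, the trivial bound by the other set suffices. *)
Lemma card_restricted_sumset_prime q (A B S : {set 'F_q}) :
    prime q -> (2 < q)%N -> (0 < #|S| < q)%N -> A != set0 -> B != set0 ->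
  (minn q (#|A| + #|B| - #|S| - 2) <= #|restricted_sumset S A B|)%N.
Proof.
move=> q_pr q_gt2 /andP[S_gt0 Sq] A0 B0.
have := leq_card_restricted_sumset S A B0.
have := leq_card_restricted_sumsetr S B A0.
have [A_le1 |A_gt1 _] := leqP #|A| 1.
  by move: A_le1; move: #|A| #|B| #|S| #|restricted_sumset S A B| => a b s c; lia.
have [B_le1|B_gt1 _] := leqP #|B| 1.
  by move: B_le1; move: #|A| #|B| #|S| #|restricted_sumset S A B| => a b s c; lia.
have Aq : (#|A| <= q)%N by rewrite -[X in (_ <= X)%N](card_Fp q_pr) max_card.
have [AB|AB] := leqP (#|A| + #|B|) (q + #|S| + 2)%N.
  by have := card_restricted_sumset_small q_pr q_gt2 Sq A_gt1 B_gt1 AB; lia.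
have subB : (q + #|S| + 2 - #|A| <= #|B|)%N by rewrite leq_subLR ltnW.
have [B' sB cB] := exists_subset_card subB.
have sC := subset_leq_card (restricted_sumset_sub (subxx S) (subxx A) sB).
have cA : (#|A| + #|B'| = q + #|S| + 2)%N by rewrite cB subnKC // -addnA (leq_trans Aq) ?leq_addr.
have B'_gt1 : (1 < #|B'|)%N by rewrite cB; lia.
have := card_restricted_sumset_small q_pr q_gt2 Sq A_gt1 B'_gt1; rewrite cA leqnn.
move=> /(_ isT); rewrite !leq_add2r => qC'.
by rewrite (leq_trans (geq_minl _ _)) // (leq_trans qC').
Qed.
End PrimeField.

(** * Finite abelian groups *)

Section CauchyDavenport.
Local Open Scope ring_scope.
Variable G : finZmodType.
Implicit Types (A B : {set G}).

Lemma leq_pG_of_dvdn n : (1 < n)%N -> (n %| #|[set: G]|)%N -> (pG G <= n)%N.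
Proof. exact: pdiv_min_dvd. Qed.

(** [A] contains a translate of the subgroup generated by [d], whose order divides that of [G]. *)
Lemma leq_pG_of_stable A d : A != set0 -> d != 0 ->
  (forall a, a \in A -> a + d \in A) -> (pG G <= #|A|)%N.
Proof.
case/set0Pn => a aA d0 Ad.
have Ad_n n : a + d *+ n \in A.
  by elim: n => [|n IHn]; rewrite ?addr0 // mulrSr addrA Ad.
have expd n : (d ^+ n)%g = d *+ n.
  by elim: n => // n IHn; rewrite expgS IHn zmodMgE mulrS.
have sub : [set a + x | x in <[d]>%g] \subset A.
  by apply/subsetP => x /imsetP[y /cycleP[n ->] ->]; rewrite expd.
apply: leq_trans (subset_leq_card sub); rewrite card_imset; last exact: addrI.
apply: leq_pG_of_dvdn; last by apply: order_dvdG; rewrite inE.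
by rewrite order_gt1.
Qed.

(* By the Dyson transform; when it fails, [A] is stable under [B - B]. *)
Lemma cauchy_davenport A B : A != set0 -> B != set0 ->
  (minn (pG G) (#|A| + #|B| - 1) <= #|[set (a + b)%R | a in A, b in B]|)%N.
Proof.
have [n] := ubnP #|B|; elim: n A B => // n IHn A B; rewrite ltnS => Bn A0 B0.
have [[b0 b0B] [a0 a0A]] := (set0Pn _ B0, set0Pn _ A0).
(* The transform keeps [#|A| + #|B|] and creates no new sums; a shift [e = a - b] is sought for
   which [B' e] is a proper subset of [B]. *)
pose A' e := A :|: [set b + e | b in B]; pose B' e := B :&: [set a - e | a in A].
case: (pickP [pred x : G * G | [&& x.1 \in A, x.2 \in B & ~~ (B \subset B' (x.1 - x.2))]]).
  case=> a b /and3P[/= aA bB nsB]; set e := a - b in nsB.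
  have cardAB : (#|A' e| + #|B' e| = #|A| + #|B|)%N.
    have := cardsUI A [set b + e | b in B]; rewrite (card_imset _ (addIr e)) => <-; congr (_ + _)%N.
    transitivity #|[set x + e | x in B' e]|; first by apply/esym/card_imset/addIr.
    apply: eq_card => x; rewrite [RHS]inE; apply/esym; apply/andP/imsetP.
      by case=> xA /imsetP[y yB xE]; exists y; rewrite // inE yB; apply/imsetP; exists x; rewrite // xE addrK.
    case=> y; rewrite inE => /andP[yB /imsetP[z zA yE]] ->; split; last exact: imset_f.
    by rewrite yE subrK.
  have B'0 : B' e != set0.
    apply/set0Pn; exists b; rewrite inE bB; apply/imsetP; exists a => //.
    by rewrite opprB addrC subrK.
  have A'0 : A' e != set0.
    by apply/set0Pn; exists a; rewrite inE aA.
  have B'n : (#|B' e| < n)%N.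
    apply: leq_trans Bn; apply: proper_card; rewrite properE subsetIl.
    by apply: contra nsB.
  apply: leq_trans (subset_leq_card _).
    by rewrite -cardAB; apply: IHn.
  apply/subsetP => c /imset2P[x y]; rewrite !inE => /orP[xA|/imsetP[z zB ->]] /andP[yB /imsetP[t tA yE]] ->.
    exact: imset2_f.
  by rewrite yE addrACA subrr addr0 addrC imset2_f.
move=> stable; have {}stable a b b' : a \in A -> b \in B -> b' \in B -> a + (b' - b) \in A.
  move=> aA bB b'B; have := stable (a, b); rewrite /= aA bB /= => /negbFE /subsetP /(_ _ b'B).
  rewrite inE b'B /= => /imsetP[z zA ->].
  by rewrite opprB [z + _]addrA [_ - a - b]addrAC addrK addrCA subrr addr0.
(* Either [B] is a singleton and the sumset is a translate of [A], or [A] is stable under the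
   nonzero shift [b - b0]. *)
have [B1|/set0Pn [b]] := eqVneq (B :\ b0) set0.
  rewrite (cardsD1 b0 B) b0B B1 cards0 addnK (leq_trans (geq_minr _ _)) //.
  rewrite -(card_imset (mem A) (addIr b0)) subset_leq_card //.
  by apply/subsetP => x /imsetP[a aA ->]; apply: imset2_f.
rewrite !inE => /andP[bb0 bB]; rewrite (leq_trans (geq_minl _ _)) //.
apply: (@leq_trans #|A|); last first.
  rewrite -(card_imset (mem A) (addIr b0)) subset_leq_card //.
  by apply/subsetP => x /imsetP[a aA ->]; apply: imset2_f.
apply: (@leq_pG_of_stable A (b - b0)) => // [|a aA]; first by rewrite subr_eq0.
exact: stable.
Qed.

(** For [K] maximal normal in [H], the quotient is simple and abelian, hence cyclic of prime order
    [q]; [phi] is the discrete logarithm to the base of a generator. *)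
Lemma exists_prime_labelling (H : {group G}) : H :!=: 1%g ->
  exists q (phi : G -> 'F_q) (K : {group G}),
    [/\ prime q, (pG G <= q)%N, (#|K| < #|H|)%N,
        {in H &, {morph phi : x y / x - y}} &
        forall x, x \in H -> (x \in K) = (phi x == 0)].
Proof.
move=> /ex_maxnormal_ntrivg[K maxK].
have /andP[sKH nKH] := maxnormal_normal maxK.
have HK_simple : simple (H / K)%g by rewrite quotient_simple ?/normal ?sKH.
have abH : abelian H by exact: zmod_abelian.
have q_pr : prime #|(H / K)%g|.
  by apply: simple_sol_prime => //; apply/abelian_sol/quotient_abelian.
have /cyclicP[z zE] := prime_cyclic q_pr.
set q := #|(H / K)%g| in q_pr.
have oz : #[z]%g = q by rewrite /order -zE.
(* The default branch is reached only outside [H]. *)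
pose phi x : 'F_q :=
  if [pick n : 'I_q | coset K x == (z ^+ n)%g] is Some n then n%:R else 0.
have phiE x n : coset K x = (z ^+ n)%g -> phi x = n%:R.
  move=> xE; rewrite /phi; case: pickP => [m|/(_ (Ordinal (ltn_pmod n (prime_gt0 q_pr))))].
    rewrite xE eq_expg_mod_order oz => /eqP nE.
    by rewrite -(Fp_nat_mod q_pr) -nE Fp_nat_mod.
  by rewrite xE eq_expg_mod_order oz /= modn_mod eqxx.
have phi_ex x : x \in H -> exists2 n, coset K x = (z ^+ n)%g & phi x = n%:R.
  move=> xH; have : coset K x \in <[z]>%g by rewrite -zE mem_quotient.
  by case/cycleP => n xE; exists n; rewrite // (phiE x n).
exists q, phi, K; split => //.
- apply: leq_pG_of_dvdn; first exact: prime_gt1.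
  by rewrite (dvdn_trans (dvdn_quotient _ _)) // cardSg // subsetT.
- by rewrite proper_card //; case/maxgroupP: maxK => /andP[].
- move=> x y xH yH; rewrite -[LHS](addrK (phi y)); congr (_ - _).
  have xyH : x - y \in H by rewrite -zmodVgE -zmodMgE groupM ?groupV.
  have [n nE ->] := phi_ex _ xyH; have [m mE ->] := phi_ex _ yH.
  rewrite -natrD; apply/esym/phiE.
  have -> : coset K x = coset K ((x - y)%R * y)%g by rewrite zmodMgE subrK.
  by rewrite morphM ?(subsetP nKH) //= nE mE expgD.
- move=> x xH; have [n xE ->] := phi_ex x xH.
  rewrite -(dvdn_pcharf (pchar_Fp q_pr)) -oz order_dvdn -xE.
  by apply/idP/eqP => [|xK1]; [exact: coset_id|exact: coset_idr (subsetP nKH x xH) xK1].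
Qed.
End CauchyDavenport.

(** * Fibres over a quotient of prime order *)

(** Layer-cake identity: [i] is counted once at each level below [minn (f i) m]. *)
Lemma sum_minn_layers (I : finType) (P : pred I) (f : I -> nat) (m : nat) :
  \sum_(i | P i) minn (f i) m = \sum_(t < m) #|[set i | P i & t < f i]|.
Proof.
elim: m => [|m IHm]; first by rewrite big_ord0 big1 // => i _; rewrite minn0.
rewrite big_ord_recr -IHm /= -sum1_card.
under [X in _ = _ + X]eq_bigl do rewrite inE.
rewrite big_mkcondr -big_split; apply: eq_bigr => i _ /=.
by case: (ltnP m (f i)) => h; lia.
Qed.

(** The inequalities at the levels [t < m] are added up; these levels exhaust [f], and the levels of
    [g] above them only help. *)
Lemma leq_sum_layers (I J : finType) (P : pred I) (f : J -> nat) (g : I -> nat) (m d e : nat) :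
    (forall t, t < m -> #|[set j | t < f j]| + d <= #|[set i | P i & t < g i]| + e) ->
    (forall j, f j <= m) ->
  \sum_j f j + d * m <= \sum_(i | P i) g i + e * m.
Proof.
move=> fg fm.
have -> : \sum_j f j = \sum_(t < m) #|[set j | t < f j]|.
  rewrite -(sum_minn_layers xpredT); apply: eq_bigr => j _.
  by rewrite (minn_idPl (fm j)).
have : \sum_(t < m) #|[set i | P i & t < g i]| <= \sum_(i | P i) g i.
  by rewrite -sum_minn_layers; apply: leq_sum => i _; apply: geq_minl.
rewrite -(leq_add2r (e * m)); apply: leq_trans.
have cst n : n * m = \sum_(t < m) n by rewrite sum_nat_const card_ord mulnC.
by rewrite !cst -!big_split /=; apply: leq_sum => t _; apply: fg.
Qed.

Definition fibre (T : finType) (U : eqType) (phi : T -> U) (X : {set T}) (i : U) : {set T} :=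
  [set x in X | phi x == i].

Lemma sum_card_fibre (T U : finType) (phi : T -> U) (X : {set T}) :
  \sum_i #|fibre phi X i| = #|X|.
Proof.
rewrite -sum1_card (partition_big phi xpredT) //=; apply: eq_bigr => i _.
by rewrite -sum1_card; apply: eq_bigl => x; rewrite inE.
Qed.

Lemma fibre_gt0 (T U : finType) (phi : T -> U) (X : {set T}) i :
  (0 < #|fibre phi X i|) = (i \in phi @: X).
Proof.
rewrite card_gt0; apply/set0Pn/imsetP => [[x]|[x xX ->]]; last by exists x; rewrite inE xX eqxx.
by rewrite inE => /andP[xX /eqP <-]; exists x.
Qed.

Section Fibres.
Variables (G : finZmodType) (H : {group G}) (q : nat) (phi : G -> 'F_q).
Variables (A B S : {set G}) (j1 : 'F_q).
Hypothesis phiB : {in H &, {morph phi : x y / (x - y)%R}}.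
Hypotheses (q_pr : prime q) (q_gt2 : 2 < q) (pq : pG G <= q).
Hypotheses (AH : A \subset H) (BH : B \subset H) (SH : S \subset H).
Hypotheses (A0 : A != set0) (B0 : B != set0) (S0 : S != set0).
Let C := restricted_sumset S A B.
(** The opposite case satisfies the final bound at once. With [pq], this rules out the terms [pG G]
    and [q] in the minima of the sumset bounds. *)
Hypothesis Cp : #|C| < pG G.
Hypothesis Sq : #|S| < q.
Let alpha (i : 'F_q) := #|fibre phi A i|.
Let beta (j : 'F_q) := #|fibre phi B j|.
Let gamma (c : 'F_q) := #|fibre phi C c|.
Let sigma (t : 'F_q) := #|fibre phi S t|.
Let I := phi @: A.
Let J := phi @: B.
Let T := phi @: S.
Hypothesis j1_max : forall j, beta j <= beta j1.
Let k := #|I|. Let l := #|J|. Let r := #|T|. Let m := beta j1.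
(** The fibres of [C] over the column [I + j1] are estimated one by one, from the pairs of a fibre
    of [A] with the largest fibre of [B]; those outside it are counted by levels. *)
Let outside (c : 'F_q) := c \notin [set (i + j1)%R | i in I].

Lemma phiD x y : x \in H -> y \in H -> phi (x + y)%R = (phi x + phi y)%R.
Proof.
move=> xH yH; have -> : phi y = (phi (x + y) - phi x)%R; last by rewrite [RHS]addrC subrK.
by rewrite -phiB ?[(x + y)%R]addrC ?addrK // -zmodMgE groupM.
Qed.

(** Differences of elements over [i] and [j] lie over [i - j], so only that fibre of [S] can forbid
    a pair. *)
Lemma fibre_restricted_sumset (i j : 'F_q) :
  restricted_sumset (fibre phi S (i - j)%R) (fibre phi A i) (fibre phi B j)
    \subset fibre phi C (i + j)%R.
Proof.
apply/subsetP => c /restricted_sumsetP[a [b []]]; rewrite !inE.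
move=> /andP[aA /eqP ai] /andP[bB /eqP bj] abS ->.
have [aH bH] := (subsetP AH a aA, subsetP BH b bB).
rewrite phiD // ai bj eqxx andbT; apply/restricted_sumsetP; exists a, b; split=> //.
by apply: contra abS => ->; rewrite phiB // ai bj /=.
Qed.

Lemma leq_beta_gamma (i j : 'F_q) : i \in I -> beta j <= gamma (i + j)%R + sigma (i - j)%R.
Proof.
rewrite -fibre_gt0 card_gt0 => Ai.
apply: leq_trans (leq_card_restricted_sumsetr (fibre phi S (i - j)%R) _ Ai) _.
by rewrite leq_add2r subset_leq_card // fibre_restricted_sumset.
Qed.

Lemma leq_alpha_gamma (i j : 'F_q) : j \in J -> alpha i <= gamma (i + j)%R + sigma (i - j)%R.
Proof.
rewrite -fibre_gt0 card_gt0 => Bj.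
apply: leq_trans (leq_card_restricted_sumset (fibre phi S (i - j)%R) _ Bj) _.
by rewrite leq_add2r subset_leq_card // fibre_restricted_sumset.
Qed.

Lemma sum_gamma : \sum_c gamma c = #|C|.
Proof. exact: sum_card_fibre. Qed.

Lemma leq_gamma (c : 'F_q) : gamma c <= #|C|.
Proof. by rewrite subset_leq_card //; apply/subsetP => x; rewrite inE => /andP[]. Qed.

(** No pair of these two fibres is forbidden, so Cauchy-Davenport applies. *)
Lemma leq_alpha_beta_gamma (i j : 'F_q) : i \in I -> j \in J -> (i - j)%R \notin T ->
  alpha i + beta j <= (gamma (i + j)%R).+1.
Proof.
rewrite -!fibre_gt0 !card_gt0 negbK => Ai Bj /eqP Sij.
have := cauchy_davenport Ai Bj.
set X := [set _ | _ in _, _ in _] => cdX.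
have XC : #|X| <= gamma (i + j)%R.
  apply/subset_leq_card/(subset_trans _ (fibre_restricted_sumset i j)).
  apply/subsetP => c /imset2P[a b aA bB ->]; apply/restricted_sumsetP; exists a, b.
  by rewrite aA bB Sij inE.
have := leq_ltn_trans (leq_gamma (i + j)%R) Cp.
rewrite -/(alpha i) -/(beta j) in cdX *; lia.
Qed.

Lemma card_level t : #|[set c | t < gamma c]| <= #|C|.
Proof.
rewrite -sum_gamma -sum1_card big_mkcond leq_sum // => c _; rewrite inE.
by case: ltnP => // /(leq_ltn_trans _) ->.
Qed.

(** Off [T] nothing is forbidden, so [gamma (i + j)] is at least [beta j]: the level set of [gamma]
    contains the sumset of [I] and the level set of [beta] restricted by [T], and the prime case
    applies. *)
Lemma level_restricted_sumset t : t < m ->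
  #|[set j | t < beta j]| + k <= #|[set c | t < gamma c]| + (r + 2).
Proof.
move=> tm; set Jt := [set j | t < beta j].
have Jt0 : Jt != set0 by apply/set0Pn; exists j1; rewrite inE.
have sub : restricted_sumset T I Jt \subset [set c | t < gamma c].
  apply/subsetP => c /restricted_sumsetP[i [j [iI jJ ijT ->]]].
  move: jJ; rewrite !inE => jJ; apply: (leq_trans jJ).
  have := leq_beta_gamma j iI.
  by move: ijT; rewrite -fibre_gt0 -leqNgt leqn0 -/(sigma _) => /eqP ->; rewrite addn0.
have r_bounds : 0 < r < q.
  by rewrite card_gt0 imset_eq0 S0 (leq_ltn_trans (leq_imset_card _ _) Sq).
have I0 : I != set0 by rewrite imset_eq0.
have := card_restricted_sumset_prime q_pr q_gt2 r_bounds I0 Jt0.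
have := subset_leq_card sub; have := leq_ltn_trans (card_level t) (leq_trans Cp pq).
rewrite -/k -/r; move: #|restricted_sumset _ _ _| #|Jt| #|[set c | _]| k r => *; lia.
Qed.

(** Giving up [s0] levels pays for the forbidden pairs in every fibre, so the unrestricted
    Cauchy-Davenport bound can be used in ['F_q]. *)
Lemma level_sumset s0 t : (forall u, sigma u <= s0) -> t + s0 < m ->
  #|[set j | t + s0 < beta j]| + k <= #|[set c | t < gamma c]| + 1.
Proof.
move=> s0_max tm; set Jt := [set j | t + s0 < beta j].
have Jt0 : Jt != set0 by apply/set0Pn; exists j1; rewrite inE.
have sub : [set (i + j)%R | i in I, j in Jt] \subset [set c | t < gamma c].
  apply/subsetP => c /imset2P[i j iI jJ ->].
  rewrite !inE in jJ *; have := leq_beta_gamma j iI; have := s0_max (i - j)%R.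
  move: (gamma _) (sigma _) (beta _) jJ => *; lia.
have I0 : I != set0 by rewrite imset_eq0.
have := cauchy_davenport I0 Jt0.
have -> : pG 'F_q = q by rewrite /pG cardsT card_Fp // pdiv_id.
have := subset_leq_card sub; have := leq_ltn_trans (card_level t) (leq_trans Cp pq).
rewrite -/k; move: #|[set (_ + _)%R | _ in _, _ in _]| #|Jt| #|[set c | _]| k => *; lia.
Qed.

Lemma sum_beta : \sum_j beta j = #|B|.
Proof. exact: sum_card_fibre. Qed.

Lemma leq_card_levels : #|B| + k * m <= #|C| + (r + 2) * m.
Proof.
rewrite -sum_beta -sum_gamma; apply: leq_sum_layers => // t tm.
by apply: leq_trans (level_restricted_sumset tm) _; rewrite leq_add2r subset_leq_card //;
  apply/subsetP => c; rewrite !inE.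
Qed.

Lemma card_level_outside t :
  #|[set c | t < gamma c]| <= #|[set c | outside c & t < gamma c]| + k.
Proof.
have -> : k = #|[set (i + j1)%R | i in I]| by rewrite card_imset //; apply: addIr.
rewrite addnC (leq_trans _ (leq_card_setU _ _)) //.
apply/subset_leq_card/subsetP => c; rewrite !inE => ->; rewrite andbT.
by rewrite /outside orbN.
Qed.

(** Removing the column costs each level at most [k], exactly the gain in
    [level_restricted_sumset]. *)
Lemma leq_card_outside : #|B| <= \sum_(c | outside c) gamma c + (r + 2) * m.
Proof.
rewrite -sum_beta -[X in X <= _](addn0) -(mul0n m); apply: leq_sum_layers => // t tm.
have := level_restricted_sumset tm; have := card_level_outside t.
move: #|_| #|_| #|_| k r => *; lia.
Qed.

(** The levels of the truncated sizes [beta j - s0] are summed; truncation loses at most [s0] in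
    each of the [l] nonempty fibres. For [m <= s0] the estimate [#|B| <= l * m] is enough. *)
Lemma leq_card_outside_sumset s0 : (forall u, sigma u <= s0) ->
  #|B| + s0 <= \sum_(c | outside c) gamma c + m + l * s0.
Proof.
move=> s0_max.
have sumJ : #|B| = \sum_(j in J) beta j.
  rewrite -sum_beta [RHS]big_mkcond; apply: eq_bigr => j _.
  by rewrite -fibre_gt0; case: posnP.
have l_gt0 : 0 < l by rewrite card_gt0 imset_eq0.
have [ms0|s0m] := leqP m s0.
  have : #|B| <= l * m by rewrite sumJ -sum_nat_const leq_sum.
  move: (\sum_(c | _) _) => E; nia.
have : \sum_j (beta j - s0) + 0 * (m - s0) <= \sum_(c | outside c) gamma c + 1 * (m - s0).
  apply: leq_sum_layers => [t tm|j]; last by rewrite leq_sub2r.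
  have -> : [set j | t < beta j - s0] = [set j | t + s0 < beta j].
    by apply/setP => j; rewrite !inE ltn_subRL addnC.
  have tm' : t + s0 < m by rewrite addnC -ltn_subRL.
  have := level_sumset s0_max tm'; have := card_level_outside t.
  move: #|_| #|_| #|_| k => *; lia.
have : #|B| <= \sum_j (beta j - s0) + l * s0.
  rewrite sumJ -sum_nat_const [\sum_j _](bigID (mem J)) /= -addnA addnCA.
  rewrite (leq_trans _ (leq_addl _ _)) // -big_split leq_sum // => j _.
  by rewrite /=; lia.
move: (\sum_(c | _) _) (\sum_j _) => E F; lia.
Qed.

(** [L] is the loss caused by one fibre of [S]. Since [i - j1] determines [i], each fibre of [S] is
    charged at most once. *)
Lemma leq_card_column (L : 'F_q -> nat) :
    (forall i, i \in I -> alpha i + m <= (gamma (i + j1)%R).+1 + L (i - j1)%R) ->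
  #|A| + k * m + \sum_(c | outside c) gamma c <= #|C| + k + \sum_t L t.
Proof.
move=> hL.
have sumI : #|A| = \sum_(i in I) alpha i.
  rewrite -(sum_card_fibre phi) [RHS]big_mkcond; apply: eq_bigr => j _.
  by rewrite -fibre_gt0; case: posnP.
rewrite -sum_gamma [X in _ <= X + _ + _](bigID outside) /=.
have -> : \sum_(c | ~~ outside c) gamma c = \sum_(i in I) gamma (i + j1)%R.
  have inj : {in I &, injective (fun i : 'F_q => (i + j1)%R)} by move=> x y _ _ /(addIr j1).
  rewrite -(big_imset gamma inj) /=.
  by apply: eq_bigl => c; rewrite /outside negbK.
have : \sum_(i in I) L (i - j1)%R <= \sum_t L t.
  rewrite [X in _ <= X](reindex_inj (addIr (- j1)%R)) [X in _ <= X](bigID (mem I)) /=.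
  exact: leq_addr.
have : #|A| + k * m <= \sum_(i in I) gamma (i + j1)%R + k + \sum_(i in I) L (i - j1)%R.
  rewrite sumI /k -sum_nat_const -[X in _ + X + _]sum1_card -!big_split /=.
  by apply: leq_sum => i iI; rewrite addn1 hL.
set E := \sum_(c | outside c) _; set X := \sum_(i in I) gamma _.
set Y := \sum_(i in I) L _; set Z := \sum_t L t; set W := k * m => h1 h2.
by rewrite addnC -!addnA leq_add2l addnA (leq_trans h1) // leq_add2l.
Qed.

Lemma j1_in_J : j1 \in J.
Proof.
rewrite -fibre_gt0; have [b bB] := set0Pn _ B0.
apply: leq_trans (j1_max (phi b)); rewrite fibre_gt0.
exact: imset_f.
Qed.

(** Over [T] only the fibre of [A] is kept, a loss of [sigma + (m - 1)]; elsewhere Cauchy-Davenport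
    loses nothing. *)
Lemma leq_card_column_trivial :
  #|A| + k * m + \sum_(c | outside c) gamma c <= #|C| + k + (#|S| + r * (m - 1)).
Proof.
have m_gt0 : 0 < m by rewrite fibre_gt0 j1_in_J.
have -> : #|S| + r * (m - 1) = \sum_t (sigma t + (t \in T) * (m - 1)).
  rewrite big_split /= sum_card_fibre -big_distrl /=; congr (_ + _ * _).
  by rewrite /r -sum1_card big_mkcond; apply: eq_bigr => t _; case: (t \in T).
apply: leq_card_column => i iI.
have := leq_alpha_gamma i j1_in_J.
have [_|ijT] := boolP ((i - j1)%R \in T); first by rewrite mul1n; lia.
by move: (leq_alpha_beta_gamma iI j1_in_J ijT); rewrite -/m; lia.
Qed.

(** Each nonempty fibre other than the one over [t] has at least one element. *)
Lemma leq_card_image_fibre t : r + sigma t <= #|S|.+1.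
Proof.
have [tT|] := boolP (t \in T); last first.
  rewrite -fibre_gt0 -/(sigma t) -leqNgt leqn0 => /eqP ->.
  by rewrite addn0 leqW // leq_imset_card.
have hT : #|T :\ t| <= \sum_(u | u != t) sigma u.
  rewrite -sum1_card big_mkcond [X in _ <= X]big_mkcond.
  apply: leq_sum => u _; rewrite !inE; case: (u == t) => //=.
  by case: ifP => //; rewrite fibre_gt0.
rewrite -(sum_card_fibre phi S) (bigD1 t) //= /r (cardsD1 t T) tT.
by rewrite add1n addSn ltnS addnC leq_add2l.
Qed.

End Fibres.

(** * Numerical consequences of the fibre estimates *)

(** The loss [3 x ^ 2 - 1], truncated to 0 for an empty fibre, is superadditive, so the losses of
    the fibres of [S] total at most that of [S]. *)
Lemma sum_3sqr_sub1 (T : finType) (f : T -> nat) :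
  \sum_t (3 * f t ^ 2 - 1) <= 3 * (\sum_t f t) ^ 2 - 1.
Proof.
elim/big_rec2: _ => // t x y _ xy; apply: leq_trans (leq_add (leqnn _) xy) _.
by case: (f t) x {xy} => [|u] [|x]; rewrite ?addn0 //; nia.
Qed.

(* [a], [b], [c], [s] are the sizes of [A], [B], [A (+)_S B] and [S]; [k], [l], [r] count
   the fibres that they meet; [m] and [s0] are the largest fibre sizes of [B] and [S]. *)
Record fibre_profile (a b c s k l r s0 m : nat) : Prop := FibreProfile {
  profile_m_gt0 : 0 < m;
  profile_b : b <= l * m;
  profile_r_gt0 : 0 < r;
  profile_s0_gt0 : 0 < s0;
  profile_r_s0 : r + s0 <= s.+1;
  profile_levels : b + k * m <= c + (r + 2) * m;
  profile_trivial : a + k * m + b <= c + k + (s + r * (m - 1)) + (r + 2) * m;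
  profile_weak : a + k * m + b <= c + k + (3 * s ^ 2 - 1) + (r + 2) * m;
  profile_weak_sumset : a + k * m + b + s0 <= c + k + (3 * s ^ 2 - 1) + m + l * s0
}.

(** For [k >= 2 r + 3] the gain [k * m] absorbs [k + (r + 2) * m]. Otherwise [m <= s0] would make
    [l * m] too small for [b], so [s0 <= m - 1], and [profile_weak_sumset] reduces the claim to
    [(l - 1) s0 <= (k - 1) (m - 1)]. *)
Lemma weak_of_profile a b c s k l r s0 m :
    fibre_profile a b c s k l r s0 m -> l <= k -> 1 < m -> 3 * s ^ 2 < b + s ->
  a + b <= c.+1 + (3 * s ^ 2 - 1).
Proof.
case=> _ blm r_gt0 s0_gt0 rs0 _ _ hX1 hX2 lk m_gt1 bs.
have [m' mE] : exists m', m = m' + 2 by exists (m - 2); lia.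
have [kr|kr] := leqP (2 * r + 3) k.
  have [x xE] : exists x, k = 2 * r + 3 + x by exists (k - 2 * r - 3); lia.
  have xm := (leq0n (x * m'), leq0n (r * m')); case: xm => xm rm.
  by subst k m; lia.
have s0m : s0 <= m - 1.
  rewrite leqNgt; apply/negP => ms0.
  have [u uE] : exists u, s = r + u by exists (s - r); lia.
  have : l * m <= (2 * r + 2) * (u + 1) by apply: leq_mul; lia.
  have [v vE] : exists v, r = v.+1 by exists r.-1; lia.
  have : 2 <= 3 * (v * v) + 3 * v + 4 * (u * v) + u + 3 * (u * u).
    have [u' u'E] : exists u', u = u'.+1 by exists u.-1; lia.
    by subst u; lia.
  by rewrite -mulnn in bs; move=> h1 h2; subst s r; lia.
have l_gt0 : 0 < l.
  case: posnP blm => // ->; rewrite mul0n leqn0 => /eqP b0.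
  by move: bs; rewrite b0 -mulnn ltnNge; case: (s) => // s'; rewrite mulnA leq_pmull.
have [k' kE] : exists k', k = k' + 1 by exists (k - 1); lia.
have h : (l - 1) * s0 <= k' * (m - 1) by apply: leq_mul => //; lia.
have [l' lE] : exists l', l = l' + 1 by exists (l - 1); lia.
by subst k m l; rewrite (_ : l' + 1 - 1 = l') in h; lia.
Qed.

(** The negated claim times [k] and the size bound times [k - 1] eliminate [D = m - 1 - s0]. The
    resulting inequality in [k], [s], [s0] is refuted by shifting variables for [k >= 6] and value
    by value below. *)
Lemma few_fibres_ineq (k m s s0 : nat) : 1 < k -> 1 < s -> 0 < s0 -> 9 * s ^ 2 <= k * m + 5 * s + 3 ->
  2 * s0 + k <= 2 * s + 4 -> s0 <= s ->
  3 * s ^ 2 <= (k - 1) * (m - 1 - s0) + s + 2.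
Proof.
move=> k_gt1 s_gt1 s0_gt0 bs ks s0s; rewrite leqNgt; apply/negP => small.
have kD : 9 * s ^ 2 <= k * (m - 1 - s0) + k * (1 + s0) + 5 * s + 3.
  rewrite -mulnDr (leq_trans bs) // !leq_add2r leq_mul2l; lia.
move: (m - 1 - s0) small kD => D small kD.
have [j jE] : exists j, k = j + 2 by exists (k - 2); lia.
subst k; rewrite (_ : j + 2 - 1 = j + 1) in small; last lia.
have h1 := leq_mul (leqnn (j + 2)) small.
have h2 := leq_mul (leqnn (j + 1)) kD.
have lt : (j + 1) * (9 * s ^ 2) + (j + 2) * (s + 3) <=
    (j + 2) * (3 * s ^ 2) + (j + 1) * ((j + 2) * (1 + s0) + 5 * s + 3) by lia.
clear small kD bs h1 h2 k_gt1 D m.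
have h3 : 2 * ((j + 1) * ((j + 2) * s0)) + (j + 1) * ((j + 2) * (j + 2)) <= (j + 1) * ((j + 2) * (2 * s + 4)).
  have := leq_mul (leqnn ((j + 1) * (j + 2))) ks; rewrite -[_ * _ * (2 * s + 4)]mulnA; apply: leq_trans; rewrite -mulnA; lia.
case: (leqP 4 j) => hj.
  have [v vE] : exists v, j = v + 4 by exists (j - 4); lia.
  have [z zE] : exists z, 2 * s = v + 4 + z by exists (2 * s - v - 4); lia.
  have s2 : 4 * s ^ 2 = (v + 4 + z) ^ 2 by rewrite -zE; lia.
  subst j.
  have : 4 * (v*s) = 2 * (v * (v + 4 + z)) by rewrite -zE; lia.
  have : 4 * (v*(v*s)) = 2 * (v * (v * (v + 4 + z))) by rewrite -zE; lia.
  have : 4 * (v*s^2) = v * (v + 4 + z)^2 by rewrite -zE; lia.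
  have := (leq0n (v * v * v), leq0n (v * v * z), leq0n (v * z * z), leq0n (v * v), leq0n (v * z), leq0n (z * z)).
  move=> [[[[[? ?] ?] ?] ?] ?]; rewrite -!mulnn in lt s2 *; lia.
have [u uE] : exists u, s = u + 2 by exists (s - 2); lia.
subst s; have uu := leq0n (u * u); rewrite -!mulnn in lt.
by case: j hj lt h3 ks => [|[|[|[|//]]]] _; lia.
Qed.

(** For [k >= 2 r + 3], [profile_trivial] reduces the claim to [r <= (x + 1) (m' + 1)], whose
    failure forces [b <= (3 s + 1) s]. For smaller [k], [profile_weak_sumset] with [l <= k] reduces
    it to [few_fibres_ineq]. *)
Lemma strong_of_profile a b c s k l r s0 m :
    fibre_profile a b c s k l r s0 m -> l <= k -> 1 < k -> 1 < m -> 1 < s ->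
    9 * s ^ 2 <= b + 5 * s + 3 ->
  a + b <= c + s + 2.
Proof.
case=> _ blm r_gt0 s0_gt0 rs0 _ hR1 _ hX2 lk k_gt1 m_gt1 s_gt1 bs.
have bkm : b <= k * m by rewrite (leq_trans blm) // leq_mul2r lk orbT.
have [m' mE] : exists m', m = m' + 2 by exists (m - 2); lia.
have [kr|kr] := leqP (2 * r + 3) k.
  have [x xE] : exists x, k = 2 * r + 3 + x by exists (k - 2 * r - 3); lia.
  have : r <= (x + 1) * (m' + 1).
    have [rm|rm] := leqP r (m' + 1).
      by rewrite (leq_trans rm) // leq_pmull // addn1.
    have [kr'|kr'] := leqP r (x + 1); first by rewrite (leq_trans kr') // leq_pmulr // addn1.
    have : k * m <= (3 * s + 1) * s by apply: leq_mul; lia.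
    rewrite -mulnn in bs; have : 2 * s <= s * s by rewrite leq_mul2r s_gt1 orbT.
    lia.
  by subst k m; rewrite (_ : m' + 2 - 1 = m' + 1) in hR1; lia.
have key : 3 * s ^ 2 <= (k - 1) * (m - 1 - s0) + s + 2.
  by apply: few_fibres_ineq => //; lia.
have [k' kE] : exists k', k = k' + 2 by exists (k - 2); lia.
have s0m : s0 <= m - 1.
  rewrite leqNgt; apply/negP => ms0; move: key; rewrite (_ : m - 1 - s0 = 0); last lia.
  rewrite muln0 -mulnn; have : 2 * s <= s * s by rewrite leq_mul2r s_gt1 orbT.
  lia.
have [D DE] : exists D, m = D + s0 + 1 by exists (m - 1 - s0); lia.
have : l * s0 <= k * s0 by rewrite leq_mul2r lk orbT.
rewrite (_ : m - 1 - s0 = D) in key; last lia.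
rewrite (_ : k - 1 = k' + 1) in key; last lia.
by subst k m; move: (s ^ 2) hX2 key => *; lia.
Qed.

(** As [k >= r + 2], replacing [m] by 1 in [profile_levels] gives [b + k <= c + r + 2]. *)
Lemma singleton_fibres_of_profile a b c s k l r s0 m :
    fibre_profile a b c s k l r s0 m -> a <= k -> s + 2 <= a -> a + b <= c + s + 2.
Proof.
case=> m_gt0 _ r_gt0 s0_gt0 rs0 hZ _ _ _ ak sa.
have : (k - (r + 2)) * 1 <= (k - (r + 2)) * m by apply: leq_mul.
nia.
Qed.

(** * Descent *)

Section Induction.
Variable G : finZmodType.
Implicit Types (A B S : {set G}) (H K : {group G}).

Definition in_one_coset (K : {set G}) A := {in A &, forall x y, (x - y)%R \in K}.

Definition weak_bound (K : {set G}) := forall A B S,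
  A != set0 -> B != set0 -> in_one_coset K A -> in_one_coset K B ->
  #|restricted_sumset S A B| < pG G ->
  #|A| + #|B| <= #|restricted_sumset S A B|.+1 + (3 * #|S| ^ 2 - 1).

Definition strong_bound (K : {set G}) := forall A B S,
  A != set0 -> B != set0 -> in_one_coset K A -> in_one_coset K B ->
  9 * #|S| ^ 2 <= #|A| + 5 * #|S| + 3 -> 9 * #|S| ^ 2 <= #|B| + 5 * #|S| + 3 ->
  #|restricted_sumset S A B| < pG G ->
  #|A| + #|B| <= #|restricted_sumset S A B| + #|S| + 2.

(** Translating by points [a0] of [A] and [b0] of [B] shifts differences by [a0 - b0]; the part of
    the shifted [S] outside [H] forbids nothing. *)
Lemma translate_to_subgroup H A B S :
    A != set0 -> B != set0 -> in_one_coset H A -> in_one_coset H B ->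
  exists A' B' S',
    [/\ A' \subset H, B' \subset H & S' \subset H] /\
    [/\ #|A'| = #|A|, #|B'| = #|B|, #|S'| <= #|S| &
        #|restricted_sumset S' A' B'| = #|restricted_sumset S A B|].
Proof.
case/set0Pn => a0 a0A /set0Pn[b0 b0B] AH BH.
pose tr (z : G) (X : {set G}) := [set (x - z)%R | x in X].
have trE z X x : ((x - z)%R \in tr z X) = (x \in X).
  exact: (mem_imset X x (addIr (- z)%R)).
have card_tr z X : #|tr z X| = #|X| := card_imset (mem X) (addIr (- z)%R).
exists (tr a0 A), (tr b0 B), (tr (a0 - b0)%R S :&: H).
have trA : tr a0 A \subset H by apply/subsetP => x /imsetP[a aA ->]; apply: AH.
have trB : tr b0 B \subset H by apply/subsetP => x /imsetP[b bB ->]; apply: BH.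
split; first by rewrite trA trB subsetIr.
split; rewrite ?card_tr //; first by rewrite -(card_tr (a0 - b0)%R S) subset_leq_card ?subsetIl.
rewrite -[RHS](card_tr (a0 + b0)%R); apply: eq_card => c.
have subE (a b : G) : ((a - a0) - (b - b0) = (a - b) - (a0 - b0))%R.
  by rewrite !opprB addrACA [RHS]addrACA; congr (_ + _)%R; apply: addrC.
apply/restricted_sumsetP/imsetP => [[a' [b' [a'A b'B abS ->]]]|[c' /restricted_sumsetP[a [b [aA bB abS ->]] ->]]].
  have [a'H b'H] := (subsetP trA _ a'A, subsetP trB _ b'B).
  case/imsetP: a'A a'H abS => a aA -> aH; case/imsetP: b'B b'H => b bB -> bH abS.
  exists (a + b)%R; last by rewrite addrACA opprD.
  apply/restricted_sumsetP; exists a, b; split=> //; apply: contra abS => abS.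
  rewrite inE -zmodVgE -zmodMgE groupM ?groupV // andbT zmodMgE zmodVgE.
  by rewrite subE trE.
exists (a - a0)%R, (b - b0)%R; split; rewrite ?trE //; last by rewrite addrACA opprD.
by rewrite inE subE trE (negPf abS).
Qed.

Lemma restricted_sumset0 A B :
  restricted_sumset set0 A B = [set (a + b)%R | a in A, b in B].
Proof.
apply/setP => c; apply/restricted_sumsetP/imset2P => [[a [b [aA bB _ ->]]]|[a b aA bB ->]].
  exact: (Imset2spec aA bB).
by exists a, b; rewrite inE.
Qed.

Lemma in_one_coset_of_labelling H K (q : nat) (phi : G -> 'F_q) A :
    {in H &, {morph phi : x y / (x - y)%R}} ->
    (forall x, x \in H -> (x \in K) = (phi x == 0%R)) -> A \subset H ->
    {in A &, forall x y, phi x = phi y} -> in_one_coset K A.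
Proof.
move=> phiB phiK /subsetP AH phiA x y xA yA; have [xH yH] := (AH x xA, AH y yA).
rewrite phiK; first by rewrite phiB // (phiA x y) // subrr.
by rewrite -zmodVgE -zmodMgE groupM ?groupV.
Qed.

Lemma exists_fibre_profile H K (q : nat) (phi : G -> 'F_q) A B S :
    {in H &, {morph phi : x y / (x - y)%R}} ->
    (forall x, x \in H -> (x \in K) = (phi x == 0%R)) -> weak_bound K ->
    prime q -> 2 < q -> pG G <= q -> A \subset H -> B \subset H -> S \subset H ->
    A != set0 -> B != set0 -> S != set0 ->
    #|restricted_sumset S A B| < pG G -> #|S| < q ->
  exists r s0 m, fibre_profile #|A| #|B| #|restricted_sumset S A B| #|S|
    #|phi @: A| #|phi @: B| r s0 m.
Proof.
move=> phiB phiK weakK q_pr q_gt2 pq AH BH SH A0 B0 S0 Cp Sq.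
have q_gt0 : 0 < #|'F_q| by rewrite card_Fp ?prime_gt0.
have [j1 j1E] := eq_bigmax (fun j => #|fibre phi B j|) q_gt0.
have j1_max j : #|fibre phi B j| <= #|fibre phi B j1|.
  by rewrite -j1E (leq_bigmax (F := fun j => #|fibre phi B j|)).
have [t1 t1E] := eq_bigmax (fun t => #|fibre phi S t|) q_gt0.
have t1_max t : #|fibre phi S t| <= #|fibre phi S t1|.
  by rewrite -t1E (leq_bigmax (F := fun t => #|fibre phi S t|)).
have j1J := j1_in_J B0 j1_max; have t1T := j1_in_J S0 t1_max.
have coset (X : {set G}) i : X \subset H -> in_one_coset K (fibre phi X i).
  move=> XH; apply: (in_one_coset_of_labelling phiB phiK).
    by apply: subset_trans XH; apply/subsetP => x; rewrite inE => /andP[].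
  by move=> x y; rewrite !inE => /andP[_ /eqP ->] /andP[_ /eqP ->].
have outX := leq_card_outside phiB q_pr q_gt2 pq AH BH SH A0 B0 S0 Cp Sq j1_max.
have outS := leq_card_outside_sumset phiB q_pr q_gt2 pq AH BH SH A0 B0 S0 Cp Sq j1_max t1_max.
have triv := leq_card_column_trivial phiB q_pr q_gt2 pq AH BH SH A0 B0 S0 Cp Sq j1_max.
have lev := leq_card_levels phiB q_pr q_gt2 pq AH BH SH A0 B0 S0 Cp Sq j1_max.
have pairs i : i \in phi @: A -> #|fibre phi A i| + #|fibre phi B j1| <=
    #|fibre phi (restricted_sumset S A B) (i + j1)%R|.+1
      + (3 * #|fibre phi S (i - j1)%R| ^ 2 - 1).
  move=> iI.
  have sub : restricted_sumset (fibre phi S (i - j1)%R) (fibre phi A i) (fibre phi B j1)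
      \subset fibre phi (restricted_sumset S A B) (i + j1)%R.
    exact: (fibre_restricted_sumset S phiB AH BH).
  have subC : fibre phi (restricted_sumset S A B) (i + j1)%R \subset restricted_sumset S A B.
    by apply/subsetP => x; rewrite inE => /andP[].
  rewrite -fibre_gt0 card_gt0 in iI; rewrite -fibre_gt0 card_gt0 in j1J.
  have Cp' := leq_ltn_trans (subset_leq_card (subset_trans sub subC)) Cp.
  apply: leq_trans (weakK _ _ _ iI j1J (coset _ _ AH) (coset _ _ BH) Cp') _.
  by rewrite leq_add2r ltnS subset_leq_card.
have weak := leq_card_column (L := fun t => 3 * #|fibre phi S t| ^ 2 - 1) pairs.
have := sum_3sqr_sub1 (fun t => #|fibre phi S t|); rewrite sum_card_fibre => wsum.
have {wsum}weak := leq_trans weak (leq_add (leqnn _) wsum).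
have BE : #|B| <= #|phi @: B| * #|fibre phi B j1|.
  rewrite -(sum_card_fibre phi B) -sum_nat_const [X in _ <= X]big_mkcond leq_sum // => j _.
  by case: ifP => //; rewrite -fibre_gt0; case: (posnP #|fibre phi B j|) => [->|].
exists #|phi @: S|, #|fibre phi S t1|, #|fibre phi B j1|.
move: outX outS triv lev weak BE; set E := \sum_(c | _) _ => outX outS triv lev weak BE.
(* The last three fields come from bounding the outside sum [E] below in the column estimates. *)
split; rewrite ?fibre_gt0 ?card_gt0 ?imset_eq0 ?leq_card_image_fibre //.
- by rewrite (leq_trans (leq_add (leqnn _) outX)) // addnA leq_add2r.
- by rewrite (leq_trans (leq_add (leqnn _) outX)) // addnA leq_add2r.
by rewrite -addnA (leq_trans (leq_add (leqnn _) outS)) // !addnA !leq_add2r.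
Qed.

(** Swapping [A] and [B] replaces [S] by its negative; later the set meeting fewer fibres takes the
    role of [B]. *)
Lemma exists_two_fibre_profiles H K (q : nat) (phi : G -> 'F_q) A B S :
    {in H &, {morph phi : x y / (x - y)%R}} ->
    (forall x, x \in H -> (x \in K) = (phi x == 0%R)) -> weak_bound K ->
    prime q -> 2 < q -> pG G <= q -> A \subset H -> B \subset H -> S \subset H ->
    A != set0 -> B != set0 -> S != set0 ->
    #|restricted_sumset S A B| < pG G -> #|S| < q ->
  (exists r s0 m, fibre_profile #|A| #|B| #|restricted_sumset S A B| #|S|
    #|phi @: A| #|phi @: B| r s0 m) /\
  (exists r s0 m, fibre_profile #|B| #|A| #|restricted_sumset S A B| #|S|
    #|phi @: B| #|phi @: A| r s0 m).
Proof.
move=> phiB phiK weakK q_pr q_gt2 pq AH BH SH A0 B0 S0 Cp Sq; split.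
  exact: (exists_fibre_profile phiB phiK).
rewrite restricted_sumsetC -(card_oppset S); rewrite restricted_sumsetC in Cp.
apply: (exists_fibre_profile phiB phiK) => //.
- apply/subsetP => x /imsetP[y yS ->]; rewrite -zmodVgE groupV; exact: (subsetP SH).
- by rewrite imset_eq0.
- by rewrite card_oppset.
Qed.

Lemma cauchy_davenport_restricted A B : A != set0 -> B != set0 ->
  #|restricted_sumset set0 A B| < pG G -> #|A| + #|B| <= #|restricted_sumset set0 A B|.+1.
Proof.
move=> A0 B0; rewrite restricted_sumset0; have := cauchy_davenport A0 B0.
by move: #|A| #|B| #|[set _ | _ in _, _ in _]| (pG G) => a b c p; lia.
Qed.

Lemma card_gt1_ntriv H A : A \subset H -> 1 < #|A| -> H :!=: 1%g.
Proof.
move=> AH A1; apply/eqP => H1; have := leq_trans A1 (subset_leq_card AH).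
by rewrite H1 cards1.
Qed.

Lemma weak_bound_group H : weak_bound H.
Proof.
have [n] := ubnP #|H|; elim: n H => // n IHn H; rewrite ltnS => Hn.
move=> A0' B0' S0' A0 B0 AH0 BH0.
have [A [B [S [[AH BH SH] [cA cB cS cC]]]]] := translate_to_subgroup S0' A0 B0 AH0 BH0.
rewrite -!card_gt0 -cA -cB !card_gt0 in A0 B0; rewrite -cA -cB -cC => Cp.
suff : #|A| + #|B| <= #|restricted_sumset S A B|.+1 + (3 * #|S| ^ 2 - 1).
  move=> /leq_trans; apply; rewrite leq_add2l leq_sub2r // leq_mul2l /=.
  by rewrite leq_exp2r.
have [S_0|S0] := eqVneq S set0.
  rewrite S_0 in Cp *; apply: leq_trans (cauchy_davenport_restricted A0 B0 Cp) _.
  exact: leq_addr.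
have [cA_le cB_le] := (leq_card_restricted_sumset S A B0, leq_card_restricted_sumsetr S B A0).
have s_gt0 : 0 < #|S| by rewrite card_gt0.
(* If [#|A| <= 3 s^2 - s] with [s = #|S|], the trivial bound by [#|B|] is enough. *)
have [smallA|bigA] := leqP (#|A| + #|S|) (3 * #|S| ^ 2).
  by move: #|A| #|B| #|S| #|restricted_sumset S A B| s_gt0 smallA cB_le => a b s c; lia.
have [smallB|bigB] := leqP (#|B| + #|S|) (3 * #|S| ^ 2).
  by move: #|A| #|B| #|S| #|restricted_sumset S A B| s_gt0 smallB cA_le => a b s c; lia.
have sA : #|S| + 1 < #|A|.
  by move: #|A| #|S| s_gt0 bigA => a s; rewrite -mulnn; case: s => [//|s] _; lia.
have sB : #|S| + 1 < #|B|.
  by move: #|B| #|S| s_gt0 bigB => b s; rewrite -mulnn; case: s => [//|s] _; lia.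
(* [A] is large and has at most [#|C| + #|S|] elements, where [C] is the sumset and
   [#|C| < pG G]. *)
have pC : 2 < pG G /\ #|S| < pG G.
  move: #|A| #|S| #|restricted_sumset S A B| (pG G) s_gt0 bigA cA_le Cp => a s c p.
  by rewrite -mulnn; case: s => [//|[|s]] _ h1 h2 h3; split; lia.
have A1 : 1 < #|A| by apply: leq_trans sA; rewrite addn1 ltnS.
have [q [phi [K [q_pr pq KH phiB phiK]]]] := exists_prime_labelling (card_gt1_ntriv AH A1).
have weakK := IHn K (leq_trans KH Hn).
have [[r [s0 [m prof]]] [r' [s0' [m' prof']]]] :=
  exists_two_fibre_profiles phiB phiK weakK q_pr (leq_trans pC.1 pq) pq AH BH SH A0 B0 S0 Cp
    (leq_trans pC.2 pq).
have strong_weak : #|restricted_sumset S A B| + #|S| + 2 <=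
    #|restricted_sumset S A B|.+1 + (3 * #|S| ^ 2 - 1).
  by move: #|S| #|restricted_sumset S A B| s_gt0 => s c; rewrite -mulnn; case: s => [//|s] _; lia.
have [m_le1|m_gt1] := leqP m 1.
  apply: leq_trans strong_weak; rewrite addnC; apply: (singleton_fibres_of_profile prof').
    by rewrite (leq_trans (profile_b prof)) // -[X in _ <= X]muln1 leq_mul2l m_le1 orbT.
  by rewrite addn2 -addn1.
have [m'_le1|m'_gt1] := leqP m' 1.
  apply: leq_trans strong_weak; apply: (singleton_fibres_of_profile prof).
    by rewrite (leq_trans (profile_b prof')) // -[X in _ <= X]muln1 leq_mul2l m'_le1 orbT.
  by rewrite addn2 -addn1.
have [lk|/ltnW kl] := leqP #|phi @: B| #|phi @: A|.
  exact: (weak_of_profile prof).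
by rewrite addnC; apply: (weak_of_profile prof').
Qed.

(** The induction hypothesis serves only when [A] and [B] each lie in one coset of [K]; the other
    cases descend through the weak bound for [K]. *)
Lemma strong_bound_group H : strong_bound H.
Proof.
have [n] := ubnP #|H|; elim: n H => // n IHn H; rewrite ltnS => Hn.
move=> A0' B0' S0' A0 B0 AH0 BH0.
have [A [B [S [[AH BH SH] [cA cB cS cC]]]]] := translate_to_subgroup S0' A0 B0 AH0 BH0.
rewrite -!card_gt0 -cA -cB !card_gt0 in A0 B0; rewrite -cA -cB -cC => sA sB Cp.
suff : #|A| + #|B| <= #|restricted_sumset S A B| + #|S| + 2.
  by move=> /leq_trans; apply; rewrite leq_add2r leq_add2l.
have mono a : 9 * #|S0'| ^ 2 <= a + 5 * #|S0'| + 3 -> 9 * #|S| ^ 2 <= a + 5 * #|S| + 3.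
  have [d ->] : exists d, #|S0'| = #|S| + d by exists (#|S0'| - #|S|); rewrite subnKC.
  move: #|S| => s; rewrite -!mulnn; case: d => [|d]; first by rewrite addn0.
  have := (leq0n (s * d), leq0n (d * d)); lia.
have {sA}sA := mono _ sA; have {sB mono}sB := mono _ sB.
have [S_0|S0] := eqVneq S set0.
  rewrite S_0 in Cp *; apply: leq_trans (cauchy_davenport_restricted A0 B0 Cp) _.
  by rewrite cards0 addn0 addn2 leqnSn.
have coset_sub (X : {set G}) : X \subset H -> in_one_coset H X.
  move=> /subsetP XH x y xX yX.
  by rewrite -zmodVgE -zmodMgE groupM ?groupV ?XH.
have s_gt0 : 0 < #|S| by rewrite card_gt0.
(* For [#|S| = 1] the weak and strong bounds coincide, as [1 + (3 - 1) = 1 + 2]. *)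
have [s_le1|s_gt1] := leqP #|S| 1.
  have := weak_bound_group A0 B0 (coset_sub _ AH) (coset_sub _ BH) Cp.
  by rewrite (_ : #|S| = 1) ?addnS ?addn0 //; apply/eqP; rewrite eqn_leq s_le1.
have cA_le := leq_card_restricted_sumset S A B0.
have sA2 : #|S| + 2 <= #|A|.
  by move: #|A| #|S| s_gt1 sA => a s; rewrite -mulnn; case: s => [//|[//|s]] _; lia.
have sB2 : #|S| + 2 <= #|B|.
  by move: #|B| #|S| s_gt1 sB => a s; rewrite -mulnn; case: s => [//|[//|s]] _; lia.
have pC : 2 < pG G /\ #|S| < pG G.
  move: #|A| #|S| #|restricted_sumset S A B| (pG G) s_gt1 sA cA_le Cp => a s c p.
  by rewrite -mulnn; case: s => [//|[//|s]] _ h1 h2 h3; split; lia.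
have A1 : 1 < #|A| by apply: leq_trans sA2; rewrite addn2.
have [q [phi [K [q_pr pq KH phiB phiK]]]] := exists_prime_labelling (card_gt1_ntriv AH A1).
have [[r [s0 [m prof]]] [r' [s0' [m' prof']]]] :=
  exists_two_fibre_profiles phiB phiK (@weak_bound_group K) q_pr (leq_trans pC.1 pq) pq AH BH SH
    A0 B0 S0 Cp (leq_trans pC.2 pq).
have [m_le1|m_gt1] := leqP m 1.
  rewrite addnC; apply: (singleton_fibres_of_profile prof') => //.
  by rewrite (leq_trans (profile_b prof)) // -[X in _ <= X]muln1 leq_mul2l m_le1 orbT.
have [m'_le1|m'_gt1] := leqP m' 1.
  apply: (singleton_fibres_of_profile prof) => //.
  by rewrite (leq_trans (profile_b prof')) // -[X in _ <= X]muln1 leq_mul2l m'_le1 orbT.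
have one_fibre (X : {set G}) : X \subset H -> #|phi @: X| <= 1 -> in_one_coset K X.
  move=> XH /card_le1_eqP X1; apply: (in_one_coset_of_labelling phiB phiK XH) => x y xX yX.
  by apply: X1; apply: imset_f.
have [k_le1|k_gt1] := leqP #|phi @: A| 1.
  have [l_le1|l_gt1] := leqP #|phi @: B| 1.
    apply: (IHn K (leq_trans KH Hn)) => //; exact: one_fibre.
  by rewrite addnC; apply: (strong_of_profile prof') => //; rewrite (leq_trans k_le1) // ltnW.
have [lk|kl] := leqP #|phi @: B| #|phi @: A|.
  exact: (strong_of_profile prof).
rewrite addnC; apply: (strong_of_profile prof' (ltnW kl) _ m'_gt1 s_gt1 sA).
exact: ltn_trans kl.
Qed.

End Induction.

Theorem theorem1p2 (G : finZmodType) (A B S : {set G})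
  (hG : 1 < #|[set: G]|)
  (hA : A != set0) (hB : B != set0) (hS : S != set0)
  (hsize : 9 * #|S| ^ 2 - 5 * #|S| - 3 <= minn #|A| #|B|) :
  minn (#|A| + #|B| - #|S| - 2) (pG G) <= #|restricted_sumset S A B|.
Proof.
rewrite geq_min; have [//|Cp] := leqP (pG G) #|restricted_sumset S A B|; rewrite ?orbT ?orbF //.
have coset (X : {set G}) : in_one_coset [set: G] X by move=> x y _ _; rewrite inE.
have sizes : 9 * #|S| ^ 2 <= #|A| + 5 * #|S| + 3 /\ 9 * #|S| ^ 2 <= #|B| + 5 * #|S| + 3.
  by move: (#|S| ^ 2) #|S| #|A| #|B| hsize => s2 s a b; lia.
have := strong_bound_group hA hB (coset A) (coset B) sizes.1 sizes.2 Cp.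
by move: #|S| #|A| #|B| #|restricted_sumset S A B| => s a b c; lia.
Qed.
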